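(* Let $n\geq 0$ be an integer, put $N=2^n$, and write the $n$-th Stern-Brocot sequence (which has $2^n+1$ terms) as $$\mathcal{SB}_n=\left[\frac{a_{-1}}{b_{-1}},\frac{a_0}{b_0},\frac{a_1}{b_1},\dots,\frac{a_{N-1}}{b_{N-1}}\right].$$ For each integer $i\geq 1$ let $k_i=2\log_2|i|_2+1$, where $|i|_2$ denotes the largest power of $2$ dividing $i$. Then $$a_{-1}=0,\quad a_0=1,\quad a_i=k_ia_{i-1}-a_{i-2}\quad\text{for } 1\leq i<N,$$ $$b_{-1}=1,\quad b_0=n,\quad b_i=k_ib_{i-1}-b_{i-2}\quad\text{for } 1\leq i<N.$$
   Context: The mediant of two fractions $\frac ab$ and $\frac cd$ is $\frac{a+c}{b+d}$. Here fractions are formal fractions, i.e. pairs (numerator, denominator), with $\frac10$ allowed and representing $\infty$. The Stern-Brocot sequences $\mathcal{SB}_n$ ($n\geq 0$) are finite sequences of fractions defined recursively: $\mathcal{SB}_0=\left[\frac01,\frac10\right]$, and for $n\geq 1$ the sequence $\mathcal{SB}_n$ is obtained from $\mathcal{SB}_{n-1}$ by inserting, between each pair of consecutive fractions, their mediant. For example $\mathcal{SB}_1=\left[\frac01,\frac11,\frac10\right]$ and $\mathcal{SB}_2=\left[\frac01,\frac12,\frac11,\frac21,\frac10\right]$. One has $|\mathcal{SB}_n|=2^n+1$. The number $\log_2|i|_2$ is the largest integer $\nu$ with $2^\nu\mid i$ (the 2-adic valuation of $i$). *)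

(* Defs.v *)
From mathcomp Require Import all_boot all_order all_algebra.

Set Implicit Arguments.
Unset Strict Implicit.
Unset Printing Implicit Defensive.

Import GRing.Theory.
Local Open Scope ring_scope.

(* Formal fractions (numerator, denominator): never reduced or identified, so
   (1, 0) is a legitimate fraction, standing for infinity. *)
Definition fraction : Type := (int * int)%type.

Definition mediant (x y : fraction) : fraction := (x.1 + y.1, x.2 + y.2).

Fixpoint insert_mediants (s : seq fraction) : seq fraction :=
  if s is x :: s' then
    if s' is y :: _ then x :: mediant x y :: insert_mediants s' else [:: x]
  else [::].

Fixpoint SB (n : nat) : seq fraction :=
  if n is m.+1 then insert_mediants (SB m) else [:: (0, 1); (1, 0)].

Lemma size_insert_mediants (x : fraction) (s : seq fraction) :
  size (insert_mediants (x :: s)) = (size s).*2.+1.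
Proof.
elim: s x => [|y s IHs] x //.
by rewrite -[LHS]/(size (insert_mediants (y :: s))).+2 IHs doubleS.
Qed.

Lemma size_SB (n : nat) : size (SB n) = (2 ^ n + 1)%N.
Proof.
elim: n => [|n IHn] //; rewrite [SB _]/=.
case: (SB n) IHn => [|x s]; first by rewrite addn1.
by rewrite /= addn1 => -[Es]; rewrite size_insert_mediants Es addn1 expnS mul2n.
Qed.

(* log_2 |i|_2, the largest v such that 2 ^ v divides i, is [logn 2 `|i|] for
   i != 0. *)
Definition k (i : int) : int := (2 * logn 2 `|i| + 1)%N%:Z.

(* Main.v *)
(* Entries 2i and 2i+1 of SB_(n+1) are entry i of SB_n and the sum of entries i
   and i+1 of SB_n. Hence an entry of odd index is the sum of its two
   neighbours, while the two neighbours of an entry x of index 2m add up to 2x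
   plus the sum of the neighbours of x in SB_n, where x has index m; the
   multiplier thus grows by 2 whenever the 2-adic valuation of the index grows
   by 1. *)
Require Import Defs.
From mathcomp Require Import all_boot all_order all_algebra.
From mathcomp Require Import zify ring.

Set Implicit Arguments.
Unset Strict Implicit.
Unset Printing Implicit Defensive.

Import Order.TTheory GRing.Theory Num.Theory.
Local Open Scope ring_scope.

(** Past the end of [s], both sides are the default [x0]. *)
Lemma nth_insert_mediants_even (x0 : fraction) (s : seq fraction) (i : nat) :
  nth x0 (insert_mediants s) i.*2 = nth x0 s i.
Proof.
elim: s i => [|x [|y s] IHs] [|i] //; first by rewrite doubleS /= !nth_nil.
by rewrite doubleS -[RHS]IHs.
Qed.

Lemma nth_insert_mediants_odd (x0 : fraction) (s : seq fraction) (i : nat) :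
  (i.+1 < size s)%N ->
  nth x0 (insert_mediants s) i.*2.+1 = mediant (nth x0 s i) (nth x0 s i.+1).
Proof.
elim: s i => [|x [|y s] IHs] [|i] // lt_i_s.
by rewrite doubleS -[RHS]IHs.
Qed.

Lemma logn2_double (m : nat) : (0 < m)%N -> logn 2 m.*2 = (logn 2 m).+1.
Proof. by move=> m_gt0; rewrite -mul2n lognM. Qed.

Lemma logn2_doubleS (m : nat) : logn 2 m.*2.+1 = 0%N.
Proof. by rewrite lognE /= dvdn2 /= odd_double. Qed.

Lemma SB_first (x0 : fraction) (n : nat) : nth x0 (SB n) 0 = (0, 1).
Proof. by elim: n => [|n IHn] //; rewrite -[0%N]/(0.*2) nth_insert_mediants_even. Qed.

(** Each step puts the mediant of 0/1 and 1/n right after 0/1. *)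
Lemma SB_second (x0 : fraction) (n : nat) : nth x0 (SB n) 1 = (1, n%:Z).
Proof.
elim: n => [|n IHn] //; rewrite -[1%N]/(0.*2.+1) nth_insert_mediants_odd.
  by rewrite SB_first IHn /mediant /= add0r intS.
by rewrite size_SB addn1 ltnS expn_gt0.
Qed.

Lemma SB_neighbours (x0 : fraction) (n j : nat) : (j.+1 < 2 ^ n)%N ->
  mediant (nth x0 (SB n) j) (nth x0 (SB n) j.+2) =
  (k j.+1%:Z * (nth x0 (SB n) j.+1).1, k j.+1%:Z * (nth x0 (SB n) j.+1).2).
Proof.
elim: n j => [|n IHn] j; first by rewrite expn0.
rewrite expnS mul2n -[SB n.+1]/(insert_mediants (SB n)) /k absz_nat => lt_j.
have [m [Em|Em]] : exists m, j = m.*2 \/ j = m.*2.+1.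
- by exists j./2; lia.
(* The middle index [j.+1] is odd: that entry is a fresh mediant, with multiplier 1. *)
- have lt_m : (m.+1 < size (SB n))%N by rewrite size_SB; lia.
  rewrite Em logn2_doubleS -doubleS !nth_insert_mediants_even.
  by rewrite nth_insert_mediants_odd // /mediant /= !mul1r.
(* The middle entry is old, and both neighbours are fresh mediants. *)
- have lt_m : (m.+1 < 2 ^ n)%N by lia.
  rewrite Em -doubleS logn2_double // nth_insert_mediants_even.
  rewrite !nth_insert_mediants_odd ?size_SB; try lia.
  have := IHn m lt_m; rewrite /k absz_nat /mediant /= => -[E1 E2].
  (* The extra 2 counts the middle entry once in each of the two mediants. *)
  have -> : (2 * (logn 2 m.+1).+1 + 1)%N%:Z
            = (2 * logn 2 m.+1 + 1)%N%:Z + 2 :> int by lia.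
  by rewrite !mulrDl -E1 -E2; congr pair; ring.
Qed.

Theorem theorem1 (n : nat) (a b : int -> int)
    (SBn : SB n = [seq (a (j%:Z - 1), b (j%:Z - 1)) | j <- iota 0 (2 ^ n + 1)]) :
  [/\ a (-1) = 0, a 0 = 1
    & forall i : int, 1 <= i < (2 ^ n)%N%:Z ->
        a i = k i * a (i - 1) - a (i - 2)]
  /\
  [/\ b (-1) = 1, b 0 = n%:Z
    & forall i : int, 1 <= i < (2 ^ n)%N%:Z ->
        b i = k i * b (i - 1) - b (i - 2)].
Proof.
have nthE j : (j <= 2 ^ n)%N ->
    nth (0, 0) (SB n) j = (a (j%:Z - 1), b (j%:Z - 1)).
  by move=> le_j; rewrite SBn (nth_map 0%N) ?size_iota ?nth_iota ?add0n //; lia.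
have [a_first b_first] : (a (-1), b (-1)) = (0, 1).
  by rewrite -(SB_first (0, 0) n) nthE.
have [a_second b_second] : (a 0, b 0) = (1, n%:Z).
  by rewrite -(SB_second (0, 0) n) nthE // expn_gt0.
suff rec (i : int) : 1 <= i < (2 ^ n)%N%:Z ->
    a i = k i * a (i - 1) - a (i - 2) /\ b i = k i * b (i - 1) - b (i - 2).
  by split; split=> // i /rec[].
(* With [i] equal to [j.+1], the middle entry at list position [i] is the term of index [i - 1],
   since the terms are numbered from -1. *)
case: i => [[|j]|j] // /andP[_ lt_j].
have := SB_neighbours (0, 0) (j := j) lt_j.
rewrite !nthE; try lia.
have -> : j.+2%:Z - 1 = j.+1%:Z by lia.
have -> : j%:Z - 1 = j.+1%:Z - 2 by lia.
by case=> <- <-; split; ring.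
Qed.
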